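(* Let $A$ be an abelian normal subgroup of finite index in a group $G$. Suppose that $B$ is a submonoid of $A$ so that $A=BB^{-1}$ and $B$ is a finitely generated maximal order. Let $S$ be a submonoid of $G$ such that $G=SS^{-1}$ and $S\cap A=B$. Then $S$ is a maximal order that satisfies the ascending chain condition on right ideals if and only if $S$ is maximal among all submonoids $T$ of $G$ with $T\cap A=B$.
   Context: $SS^{-1}=\{st^{-1}\mid s,t\in S\}$. A cancellative monoid $M$ with a left and right group of quotients $\Gamma$ is a maximal order if there does not exist a submonoid $M'$ of $\Gamma$ properly containing $M$ and such that $aM'b\subseteq M$ for some $a,b\in\Gamma$. (For $B$ the group of quotients is $A$; for $S$ it is $G$.) *)

(* Defs.v *)
From HB Require Import structures.
From mathcomp Require Import all_boot.
From mathcomp Require Import boolp classical_sets cardinality.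

Set Implicit Arguments.
Unset Strict Implicit.
Unset Printing Implicit Defensive.

Local Open Scope group_scope.
Local Open Scope classical_set_scope.

(* [groupType] is the class of possibly infinite groups. Its subgroups and
   submonoids are carried by classical sets [X : set G], and [mem X] is the
   corresponding collective predicate. *)
Section Orders.
Variable G : groupType.
Implicit Types (A M S X : set G).

Definition submonoid M : Prop := monoid_closed (mem M).

Definition subgroup A : Prop := group_closed (mem A).

Definition normal_subgroup A : Prop :=
  subgroup A /\ forall g a, A a -> A (a ^ g).

Definition abelian_subset A : Prop :=
  forall a b, A a -> A b -> commute a b.

Definition finite_index A : Prop :=
  finite_set [set [set g * a | a in A] | g in [set: G]].

Definition right_quotients X : set G := [set s / t | s in X & t in X].

Definition left_quotients X : set G := [set s^-1 * t | s in X & t in X].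

Definition fin_gen_monoid M : Prop :=
  exists2 F : set G, finite_set F & M = smallest submonoid F.

(* [M] is an order in its left and right group of quotients [Gamma], which may
   be a proper subgroup of [G]; the comparison monoids [M'] live in [Gamma]. *)
Definition maximal_order (Gamma M : set G) : Prop :=
  [/\ submonoid M, subgroup Gamma,
      Gamma = right_quotients M, Gamma = left_quotients M
    & ~ exists M' : set G,
        [/\ submonoid M', M' `<=` Gamma, M `<` M'
          & exists a b, [/\ Gamma a, Gamma b &
              [set a * x * b | x in M'] `<=` M]]].

Definition right_ideal S (I : set G) : Prop :=
  [/\ I !=set0, I `<=` S & forall x s, I x -> S s -> I (x * s)].

Definition acc_right_ideals S : Prop :=
  forall I : nat -> set G,
    (forall n, right_ideal S (I n)) -> (forall n, I n `<=` I n.+1) ->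
    exists n, forall m, n <= m -> I m = I n.

Definition maximal_submonoid_over A B S : Prop :=
  [/\ submonoid S, S `&` A = B
    & forall T : set G, submonoid T -> T `&` A = B -> S `<=` T -> T = S].

End Orders.

(* Main.v *)
(** If [s * x] lies in [A] for some [s] in [S], then every element [x] of a
    submonoid [T] containing [S] with [T `&` A = B] satisfies [s * x] in [B].
    Finitely many such [s] serve all of [G], so [T] has a common denominator
    with respect to [S]; hence a maximal order [S] is maximal over [B].
    Conversely, denominators in [G] can be moved into [B], so that
    [M' `&` A = B] for every order [M'] equivalent to [S] and containing it,
    by maximality of [B]. The chain condition holds without any maximality:
    via [x |-> s * x], a right ideal of [S] is described by finitely many
    (possibly empty) ideals of [B], and Dickson's lemma applies to [B]. *)
Require Import Defs.
From HB Require Import structures.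
From mathcomp Require Import all_boot.
From mathcomp Require Import boolp classical_sets cardinality.

Local Open Scope group_scope.
Local Open Scope classical_set_scope.

(** * Monotone subsequences of natural numbers *)

Lemma nondecreasing_subsequence (u : nat -> nat) :
  exists phi : nat -> nat,
    {homo phi : i j / (i < j)%N} /\ {homo u \o phi : i j / (i <= j)%N}.
Proof.
have tail_min N : exists m, (N <= m)%N /\ forall k, (m <= k)%N -> (u m <= u k)%N.
  have [v] := ubnP (u N); elim: v N => // v IH N leNv.
  have [[k [leNk ltk]]|nsmaller] := pselect (exists k, (N <= k)%N /\ (u k < u N)%N).
    have [m [lekm mmin]] := IH k (leq_trans ltk leNv).
    by exists m; split=> //; apply: leq_trans lekm.
  exists N; split=> // k leNk; rewrite leqNgt; apply/negP => ltk.
  by apply: nsmaller; exists k.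
have [g gP] := choice tail_min.
(* Each index minimizes [u] on the tail strictly past the previous index, so the values cannot
   decrease. *)
pose phi n := iter n (fun i => g i.+1) (g 0).
have phi_lt : {homo phi : i j / (i < j)%N}.
  by apply: homo_ltn => [|i]; [exact: ltn_trans | have [] := gP (phi i).+1].
exists phi; split=> //; apply: homo_leq => [//||i]; first exact: leq_trans.
have phi_min : forall k, (phi i <= k)%N -> (u (phi i) <= u k)%N.
  by case: i => [|i]; [have [_] := gP 0 | have [_] := gP (phi i).+1].
exact/phi_min/ltnW/phi_lt.
Qed.

(** * Elementwise closure of submonoids and subgroups *)

Lemma submonoidP {G : groupType} {M : set G} :
  submonoid M <-> M 1 /\ forall x y, M x -> M y -> M (x * y).
Proof.
split=> -[M1 MM]; split; first by move: M1; rewrite inE.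
- by move=> x y Mx My; have := MM x y; rewrite !inE; apply.
- by rewrite inE.
- by move=> x y; rewrite !inE; apply: MM.
Qed.

Lemma subgroupP {G : groupType} {A : set G} :
  subgroup A <-> A 1 /\ forall x y, A x -> A y -> A (x / y).
Proof.
split=> -[A1 AV]; split; first by move: A1; rewrite inE.
- by move=> x y Ax Ay; have := AV x y; rewrite !inE; apply.
- by rewrite inE.
- by move=> x y; rewrite !inE; apply: AV.
Qed.

Lemma subgroup_submonoid {G : groupType} {A : set G} :
  subgroup A -> submonoid A.
Proof.
move=> /subgroupP[A1 AV]; apply/submonoidP; split=> // x y Ax Ay.
have AVy : A (1 / y) by apply: AV.
by rewrite -[y]invgK -[y^-1]mul1g; apply: AV.
Qed.

Lemma submonoidX {G : groupType} {M : set G} x n :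
  submonoid M -> M x -> M (x ^+ n).
Proof.
move=> /submonoidP[M1 MM] Mx; elim: n => [//|n IH].
by rewrite expgS; apply: MM.
Qed.

(** * Dickson's lemma in finitely generated commutative monoids *)

Section FinitelyGenerated.
Context {G : groupType}.
Implicit Types (B : set G) (l : seq G).

(** The fixed order of the factors lets Dickson's lemma proceed one generator at a time; exponents
    need not be unique. *)
Fixpoint monomials l : set G :=
  if l is x :: l' then [set z | exists k y, monomials l' y /\ z = x ^+ k * y]
  else [set 1].

Lemma monomials_sub {B l} : submonoid B -> (forall x, x \in l -> B x) ->
  monomials l `<=` B.
Proof.
move=> Bm; have [B1 BM] := submonoidP.1 Bm.
elim: l => [_ _ -> //|x l IH lB _ [k [y [yl ->]]]]; apply: BM.
  by apply: submonoidX => //; apply: lB; rewrite mem_head.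
by apply: IH yl => z zl; apply: lB; rewrite inE zl orbT.
Qed.

Lemma monomials1 l : monomials l 1.
Proof. by elim: l => //= x l IH; exists 0, 1; rewrite mulg1. Qed.

Lemma monomials_gen l x : x \in l -> monomials l x.
Proof.
elim: l => //= y l IH; rewrite inE => /orP[/eqP ->|xl].
  by exists 1%N, 1; rewrite expg1 mulg1; split=> //; apply: monomials1.
by exists 0, x; rewrite mul1g; split=> //; apply: IH.
Qed.

Lemma monomials_submonoid {B l} : submonoid B -> abelian_subset B ->
  (forall x, x \in l -> B x) -> submonoid (monomials l).
Proof.
move=> Bm Bab lB; apply/submonoidP; split; first exact: monomials1.
elim: l lB => [_ _ _ -> ->|x l IH lB]; first by rewrite /= mulg1.
have l'B y : y \in l -> B y by move=> yl; apply: lB; rewrite inE yl orbT.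
have Bx : B x by apply: lB; rewrite mem_head.
move=> _ _ [k [y [yl ->]]] [m [z [zl ->]]].
exists (k + m)%N, (y * z); split; first exact: IH.
have By : B y by apply: monomials_sub yl.
have cyx : commute y (x ^+ m) by apply: Bab => //; apply: submonoidX.
by rewrite expgnDr -!mulgA; congr (_ * _); rewrite !mulgA cyx.
Qed.

(** Dickson's lemma by induction on the generators. A whole subsequence, not just one pair, is kept
    so that it can be refined again for the next exponent. *)
Lemma monomials_divisible_subsequence {B l} (f : nat -> G) :
  submonoid B -> abelian_subset B -> (forall x, x \in l -> B x) ->
  (forall n, monomials l (f n)) ->
  exists phi : nat -> nat, {homo phi : i j / (i < j)%N} /\
    forall i j, (i < j)%N -> exists2 b, B b & f (phi j) = f (phi i) * b.
Proof.
move=> Bm Bab; have [B1 BM] := submonoidP.1 Bm.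
elim: l f => [f _ fl|x l IH f lB fl].
  exists id; split=> // i j _; exists 1 => //.
  by rewrite (fl j) (fl i) mulg1.
have l'B y : y \in l -> B y by move=> yl; apply: lB; rewrite inE yl orbT.
have Bx : B x by apply: lB; rewrite mem_head.
have [k /choice[y fE]] := choice fl.
have [phi [phi_lt phiP]] := IH y l'B (fun n => (fE n).1).
have [psi [psi_lt kpsi]] := nondecreasing_subsequence (k \o phi).
exists (phi \o psi); split=> [i j /psi_lt/phi_lt //|i j ltij] /=.
have [b Bb yE] := phiP _ _ (psi_lt _ _ ltij).
have lek : (k (phi (psi i)) <= k (phi (psi j)))%N by apply/kpsi/ltnW.
exists (x ^+ (k (phi (psi j)) - k (phi (psi i))) * b).
  by apply: BM => //; apply: submonoidX.
have [yl ->] := fE (phi (psi i)); have [_ ->] := fE (phi (psi j)).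
have cyx : commute (y (phi (psi i))) (x ^+ (k (phi (psi j)) - k (phi (psi i)))).
  by apply: Bab; [apply: monomials_sub yl | apply: submonoidX].
by rewrite -{1}(subnKC lek) expgnDr yE -!mulgA; congr (_ * _); rewrite !mulgA cyx.
Qed.

Lemma fin_gen_dickson {B} (f : nat -> G) :
  submonoid B -> abelian_subset B -> fin_gen_monoid B -> (forall n, B (f n)) ->
  exists i j, (i < j)%N /\ exists2 b, B b & f j = f i * b.
Proof.
move=> Bm Bab [F /finite_seqP[l ->] BE] Bf.
have lB x : x \in l -> B x by move=> xl; rewrite BE; apply: sub_gen_smallest.
have fl n : monomials l (f n).
  (* The monomials form a submonoid containing the generators, and [B] is the smallest one. *)
  have : B `<=` monomials l by rewrite BE; apply: smallest_sub;
    [apply: monomials_submonoid lB | apply: monomials_gen].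
  exact.
have [phi [phi_lt phiP]] := monomials_divisible_subsequence f Bm Bab lB fl.
by exists (phi 0), (phi 1%N); split; [apply: phi_lt | apply: phiP].
Qed.

(** A chain that never stabilizes yields a sequence of new elements; by Dickson an earlier one
    divides a later one, which then was not new. *)
Lemma fin_gen_chain_stable {B} (J : nat -> set G) :
  submonoid B -> abelian_subset B -> fin_gen_monoid B ->
  (forall n, J n `<=` B) -> (forall n x b, J n x -> B b -> J n (x * b)) ->
  {homo J : n m / (n <= m)%N >-> n `<=` m} ->
  exists N, forall m, (N <= m)%N -> J m `<=` J N.
Proof.
move=> Bm Bab Bfg JB Jmul Jle; apply: contrapT => unstable.
(* The pair consists of a later stage and an element that is there but not yet in [J N]. *)
have step N : exists mx, (N <= mx.1)%N /\ J mx.1 mx.2 /\ ~ J N mx.2.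
  apply: contrapT => noN; apply: unstable; exists N => m leNm x Jx.
  by apply: contrapT => nJx; apply: noN; exists (m, x).
have [h hP] := choice step.
pose n k := iter k (fun N => (h N).1) 0.
have n_le : {homo n : i j / (i <= j)%N}.
  by apply: homo_leq => [//||i]; [exact: leq_trans | have [] := hP (n i)].
have fB k : B (h (n k)).2 by have [_ [/JB]] := hP (n k).
have [i [j [ltij [b Bb fE]]]] := fin_gen_dickson _ Bm Bab Bfg fB.
have [_ [_]] := hP (n j); apply; rewrite fE; apply: Jmul => //.
by apply: Jle (n_le _ _ ltij) _ _; have [_ []] := hP (n i).
Qed.

End FinitelyGenerated.

(** * Denominators from [S] modulo a normal subgroup of finite index *)

Section FiniteIndex.
Context {G : groupType} {A B S : set G}.
Hypotheses (A_normal : normal_subgroup A) (A_abelian : abelian_subset A).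
Hypotheses (A_index : finite_index A).
Hypotheses (S_submonoid : submonoid S) (G_quot : [set: G] = right_quotients S).
Hypothesis S_cap_A : S `&` A = B.

Let A1 : A 1. Proof. by have [/subgroupP[]] := A_normal. Qed.

Let AM x y : A x -> A y -> A (x * y).
Proof. by have [/subgroup_submonoid/submonoidP[_ AM] _] := A_normal; apply: AM. Qed.

Let SM x y : S x -> S y -> S (x * y).
Proof. by have [_] := submonoidP.1 S_submonoid; apply. Qed.

Let BS x : B x -> S x. Proof. by rewrite -S_cap_A => -[]. Qed.

Let BA x : B x -> A x. Proof. by rewrite -S_cap_A => -[]. Qed.

Let SA x : S x -> A x -> B x. Proof. by rewrite -S_cap_A. Qed.

Lemma normal_mulC x y : A (x * y) -> A (y * x).
Proof.
move=> Axy; have [_ /(_ x _ Axy)] := A_normal.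
by rewrite conjgE -mulgA mulKg.
Qed.

Lemma coset_refl g : [set g * a | a in A] g.
Proof. by exists 1; rewrite ?mulg1. Qed.

(** By pigeonhole two distinct powers of [g] share a coset, and their quotient is a positive power
    in [A]. *)
Lemma finite_index_expg g : exists n, A (g ^+ n.+1).
Proof.
have [cs csE] := (finite_seqP _).1 A_index.
have cosetP h : [set h * a | a in A] \in cs.
  by have : [set` cs] [set h * a | a in A]; [rewrite -csE; exists h | ].
pose c i := [set g ^+ i * a | a in A].
have : ~~ uniq [seq c i | i <- iota 0 (size cs).+1].
  apply/negP => /(@uniq_leq_size _ _ cs)-/(_ _).
  rewrite size_map size_iota ltnn => /(_ _)/notF; apply.
  by move=> _ /mapP[i _ ->]; apply: cosetP.
move=> /(uniqPn set0)[i [j [ltij]]]; rewrite size_map size_iota => ltj.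
have lti := ltn_trans ltij ltj.
rewrite !(nth_map 0) ?size_iota // !nth_iota // !add0n => cE.
have [a Aa] : c i (g ^+ j) by rewrite cE; apply: coset_refl.
exists (j - i).-1; rewrite prednK ?subn_gt0 //.
suff <- : a = g ^+ (j - i) by [].
by apply: (mulgI (g ^+ i)); rewrite -expgnDr subnKC // ltnW.
Qed.

(** With [g = t / s] and [t ^+ n.+1] in [A], the product of [s * t ^+ n] and [g] is a conjugate of
    [t ^+ n.+1]. *)
Lemma quotients_meet_coset g : exists s, S s /\ A (s * g).
Proof.
have [s Ss [t St gE]] : right_quotients S g^-1 by rewrite -G_quot.
have {gE} -> : g = t * s^-1 by rewrite -[g]invgK -gE invgM invgK.
have [n An] := finite_index_expg t.
exists (s * t ^+ n); split; first by apply/SM/submonoidX.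
by rewrite mulgA; apply: normal_mulC; rewrite -mulgA -expgSr mulKg.
Qed.

Lemma quotients_finite_transversal : exists l : seq G,
  (forall s, s \in l -> S s) /\ forall g, exists2 s, s \in l & A (s * g).
Proof.
have [cs csE] := (finite_seqP _).1 A_index.
have rep C : exists s, S s /\ forall g, C = [set g * a | a in A] -> A (s * g).
  have [[g0 ->]|nC] := pselect (exists g, C = [set g * a | a in A]).
    have [s [Ss Asg]] := quotients_meet_coset g0; exists s; split=> // g gE.
    have [a Aa <-] : [set g0 * a | a in A] g by rewrite gE; apply: coset_refl.
    by rewrite mulgA; apply: AM.
  (* A dummy value for sets that are not cosets, so that [choice] applies. *)
  exists 1; split=> [|g CE]; first by have [] := submonoidP.1 S_submonoid.
  by case: nC; exists g.
have [h hP] := choice rep; exists [seq h C | C <- cs]; split.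
  by move=> _ /mapP[C _ ->]; have [] := hP C.
move=> g; exists (h [set g * a | a in A]); last by have [_] := hP [set g * a | a in A]; apply.
apply: map_f; have : [set` cs] [set g * a | a in A] by rewrite -csE; exists g.
by [].
Qed.

(** Some positive power of each [s] lies in [B], and cancelling one [s] from it stays in [S]. The
    product of these powers serves all [s], since they commute. *)
Lemma common_denominator (l : seq G) : (forall s, s \in l -> S s) ->
  exists b, B b /\ forall s, s \in l -> S (s^-1 * b).
Proof.
elim: l => [_|s l IH lS].
  by exists 1; split=> //; apply: SA => //; have [] := submonoidP.1 S_submonoid.
have Ss : S s by apply: lS; rewrite mem_head.
have [|b [Bb bP]] := IH _; first by move=> t tl; apply: lS; rewrite inE tl orbT.
have [n An] := finite_index_expg s.
have Sn : S (s ^+ n.+1) by apply: submonoidX.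
exists (s ^+ n.+1 * b); split; first by apply: SA; [apply/SM/BS | apply/AM/BA].
move=> t; rewrite inE => /orP[/eqP ->|tl].
  by rewrite expgS -mulgA mulKg; apply/SM/BS => //; apply: submonoidX.
rewrite (A_abelian _ _ An (BA _ Bb)) mulgA.
by apply: SM => //; apply: bP.
Qed.

(** * The chain condition, and maximality over [B] from a maximal order *)

Lemma acc_right_ideals_over : submonoid B -> fin_gen_monoid B ->
  acc_right_ideals S.
Proof.
move=> Bm Bfg I Iideal Istep.
have Bab : abelian_subset B by move=> x y /BA Ax /BA; apply: A_abelian.
have [_ BM] := submonoidP.1 Bm.
have Ile : {homo I : n m / (n <= m)%N >-> n `<=` m}.
  by apply: homo_leq => [X x|Y X Z|] //; apply: subset_trans.
have [l [lS lA]] := quotients_finite_transversal.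
have stable s : S s -> exists N, forall m, (N <= m)%N ->
    forall x, I m x -> A (s * x) -> I N x.
  (* The trace on [B] of the translate of [I n] by [s]. *)
  move=> Ss; pose J n := [set y | I n (s^-1 * y) /\ B y].
  have [||n m lenm y [Iy By]|N NP] := fin_gen_chain_stable J Bm Bab Bfg.
  - by move=> n y [].
  - move=> n y b [Iy By] Bb; split; last exact: BM.
    by have [_ _ Imul] := Iideal n; rewrite mulgA; apply/Imul/BS.
  - by split=> //; apply: Ile Iy.
  exists N => m leNm x Ix Asx; have [_ IS _] := Iideal m.
  have [] : J N (s * x); last by rewrite mulKg.
  by apply: NP leNm _ _; split; [rewrite mulKg | apply/SA/Asx/SM/IS].
have [N NP] : exists N, forall s, s \in l -> forall m, (N <= m)%N ->
    forall x, I m x -> A (s * x) -> I N x.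
  elim: {lA} l lS => [_|s l IH lS]; first by exists 0.
  have [|N1 N1P] := IH _; first by move=> t tl; apply: lS; rewrite inE tl orbT.
  have [|N2 N2P] := stable s; first by apply: lS; rewrite mem_head.
  exists (maxn N1 N2) => t; rewrite inE => /orP[/eqP ->|tl] m;
    rewrite geq_max => /andP[le1 le2] x Ix Ax.
    by apply: Ile (leq_maxr N1 N2) _ _; exact: N2P le2 x Ix Ax.
  by apply: Ile (leq_maxl N1 N2) _ _; exact: N1P tl m le1 x Ix Ax.
exists N => m leNm; apply/seteqP; split=> [x Ix|]; last exact: Ile.
by have [s sl Asx] := lA x; apply: NP sl m leNm x Ix Asx.
Qed.

Lemma maximal_order_maximal_over :
  maximal_order [set: G] S -> maximal_submonoid_over A B S.
Proof.
move=> [_ _ _ _ Smax]; split=> // T Tm TA ST; apply: contrapT => TneS.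
apply: Smax; exists T; split=> //.
  by split=> // TS; apply: TneS; apply/seteqP.
have [_ TM] := submonoidP.1 Tm.
have [l [lS lA]] := quotients_finite_transversal.
have [b [Bb bP]] := common_denominator l lS.
exists 1, b; split=> // _ [t Tt <-]; rewrite mul1g.
have [s sl Ast] := lA t.
have Bts : B (t * s).
  by rewrite -TA; split; [apply/TM/ST/lS | apply: normal_mulC].
(* [t * b] splits as [t * s] in [B] times [s^-1 * b] in [S]. *)
rewrite -[t](mulgK s) -mulgA; apply: SM; first exact: BS.
exact: bP.
Qed.

(** * Moving denominators into [B], and the converse *)

Hypothesis A_quot : A = right_quotients B.

(** Once [s * g] is in [A], it is a quotient of elements of [B], whose denominator is cleared from
    the left because [A] is abelian. *)
Lemma left_multiple_in_base g : exists u, S u /\ B (u * g).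
Proof.
have [s [Ss Asg]] := quotients_meet_coset g.
have [c Bc [d Bd cdE]] : right_quotients B (s * g) by rewrite -A_quot.
exists (d * s); split; first by apply/SM/Ss/BS.
rewrite -mulgA -cdE mulgA (A_abelian _ _ (BA _ Bd) (BA _ Bc)) mulgK.
exact: Bc.
Qed.

Lemma right_multiple_in_base g : exists v, S v /\ B (g * v).
Proof.
have [s [Ss /normal_mulC Ags]] := quotients_meet_coset g.
have [c Bc [d Bd cdE]] : right_quotients B (g * s) by rewrite -A_quot.
exists (s * d); split; first by apply/SM/BS.
by rewrite mulgA -cdE mulgVK.
Qed.

Lemma maximal_over_maximal_order :
  maximal_order A B -> maximal_submonoid_over A B S ->
  maximal_order [set: G] S.
Proof.
move=> [_ _ _ _ Bmax] [_ _ Smax]; split=> //.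
- exact/subgroupP.
- apply/seteqP; split=> // g _; have [u [Su Bug]] := left_multiple_in_base g.
  by exists u => //; exists (u * g); [apply: BS | rewrite mulKg].
move=> [M [Mm _ [SsubM MnS] [a [b [_ _ aMb]]]]].
have [M1 MM] := submonoidP.1 Mm.
have BsubMA : B `<=` M `&` A by move=> x Bx; split; [apply/SsubM/BS | apply: BA].
(* Either [M] lies over [B] and contradicts the maximality of [S], or its trace on [A] properly
   contains [B] and contradicts that of [B]. *)
have [MAB|MAnB] := pselect (M `&` A `<=` B).
  by apply: MnS; rewrite (Smax M Mm _ SsubM) //; apply/seteqP.
apply: Bmax; exists (M `&` A); split=> //.
- by apply/submonoidP; split=> // x y [Mx Ax] [My Ay]; split; [apply: MM | apply: AM].
(* [a] and [b] need not lie in [A]; factors from [S] bring them into [B] while the product stays in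
   [S]. *)
have [u [Su Bua]] := left_multiple_in_base a.
have [v [Sv Bbv]] := right_multiple_in_base b.
exists (u * a), (b * v); split; [exact: BA | exact: BA |].
move=> _ [x [Mx Ax] <-]; apply: SA; last by apply/AM/BA/Bbv/AM/Ax/BA.
have -> : u * a * x * (b * v) = u * (a * x * b) * v by rewrite !mulgA.
by apply/SM/Sv/SM => //; apply: aMb; exists x.
Qed.

End FiniteIndex.

Theorem proposition3p1 (G : groupType) (A B S : set G)
    (A_normal : normal_subgroup A) (A_abelian : abelian_subset A)
    (A_index : finite_index A)
    (B_submonoid : submonoid B) (B_sub_A : B `<=` A)
    (A_quot : A = right_quotients B)
    (B_fg : fin_gen_monoid B) (B_max : maximal_order A B)
    (S_submonoid : submonoid S)
    (G_quot : [set: G] = right_quotients S)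
    (S_cap_A : S `&` A = B) :
  maximal_order [set: G] S /\ acc_right_ideals S <->
  maximal_submonoid_over A B S.
Proof.
split=> [[Smax _]|Smax]; first exact: maximal_order_maximal_over.
split.
  exact: maximal_over_maximal_order S_submonoid G_quot S_cap_A A_quot B_max Smax.
exact: acc_right_ideals_over S_submonoid G_quot S_cap_A B_submonoid B_fg.
Qed.
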